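(* For $n\ge 1$, let $p_c:\mathrm{GF}(2)^n\to\mathrm{GF}(2)$ be the clique function in $n$ variables, $p_c(\mathbf{x})=\sum_{0\le i<j\le n-1}x_ix_j$, and let $K_n^{IH}$ be the number of flat spectra of $p_c$ with respect to $\{I,H\}^n$. Then $K_n^{IH}=2^{n-1}$.
   Context: Let $I$ be the $2\times 2$ identity matrix, $H=\frac{1}{\sqrt2}\begin{pmatrix}1&1\\1&-1\end{pmatrix}$, and $N=\frac{1}{\sqrt2}\begin{pmatrix}1&i\\1&-i\end{pmatrix}$ with $i^2=-1$. For $S\subseteq\{I,H,N\}$, $S^n$ denotes the set of $|S|^n$ transforms $U=U_0\otimes U_1\otimes\cdots\otimes U_{n-1}$ with each $U_j\in S$ (the factor $U_j$ acts on the tensor position of variable $x_j$); each transform is identified with the choice $(U_0,\ldots,U_{n-1})$. For a Boolean function $p:\mathrm{GF}(2)^n\to\mathrm{GF}(2)$, let $(-1)^{p}\in\mathbb{C}^{2^n}$ be the vector with entries $(-1)^{p(\mathbf{x})}$ indexed by $\mathbf{x}=(x_0,\ldots,x_{n-1})\in\mathrm{GF}(2)^n$. The spectrum of $p$ with respect to $U$ is $P=U(-1)^p=(P_{\mathbf{k}})_{\mathbf{k}\in\mathrm{GF}(2)^n}$, and it is flat if $|P_{\mathbf{k}}|=1$ for all $\mathbf{k}$. The number of flat spectra of $p$ with respect to $S^n$ is the number of choices $(U_0,\ldots,U_{n-1})\in S^n$ for which the spectrum of $p$ is flat. *)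

(* Defs.v *)
From HB Require Import structures.
From mathcomp Require Import all_boot all_order all_algebra.
From mathcomp Require Import complex.
From mathcomp Require Import reals.
Set Implicit Arguments.
Unset Strict Implicit.
Unset Printing Implicit Defensive.
Import Order.TTheory GRing.Theory Num.Theory.
Local Open Scope ring_scope.

Section Spectra.
Variable C : numClosedFieldType.

Definition idmx2 : 'M[C]_2 := 1%:M.

Definition hadamard : 'M[C]_2 :=
  (sqrtC 2)^-1 *: \matrix_(a, b) (if (a == 1) && (b == 1) then -1 else 1).

(* 'F_2 is convertible to 'I_2, so bits index the rows and columns of the
   2 x 2 factors. *)
Definition bit_entry (M : 'M[C]_2) (a b : 'F_2) : C := M (a : 'I_2) (b : 'I_2).

Section Transforms.
Variable n : nat.

(* Entry (k, x) of U_0 (x) ... (x) U_(n-1), with rows and columns indexed by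
   GF(2)^n; the factor U_j acts on the j-th coordinate. *)
Definition tensor_entry (U : 'I_n -> 'M[C]_2) (k x : 'rV['F_2]_n) : C :=
  \prod_(j < n) bit_entry (U j) (k 0 j) (x 0 j).

(* The exponent is the representative of p x in {0, 1}. *)
Definition sign_vector (p : 'rV['F_2]_n -> 'F_2) (x : 'rV['F_2]_n) : C :=
  (-1) ^+ (p x : nat).

Definition spectrum (U : 'I_n -> 'M[C]_2) (p : 'rV['F_2]_n -> 'F_2)
    (k : 'rV['F_2]_n) : C :=
  \sum_(x : 'rV['F_2]_n) tensor_entry U k x * sign_vector p x.

Definition flat (U : 'I_n -> 'M[C]_2) (p : 'rV['F_2]_n -> 'F_2) : bool :=
  [forall k : 'rV['F_2]_n, `|spectrum U p k| == 1].

(* [seq_sub S] is the finite subtype of matrices belonging to S, so repetitions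
   in S are not counted and U ranges over S^n as tuples of factors. *)
Definition num_flat_spectra (S : seq 'M[C]_2) (p : 'rV['F_2]_n -> 'F_2) : nat :=
  #|[set U : {ffun 'I_n -> seq_sub S} | flat (fun j => ssval (U j)) p]|.

End Transforms.
End Spectra.

Definition clique (n : nat) (x : 'rV['F_2]_n) : 'F_2 :=
  \sum_(i < n) \sum_(j < n | (i < j)%N) x 0 i * x 0 j.

(* Main.v *)
(** Since [(-1)^(w choose 2)] is [((1 - i) i^w + (1 + i) (-i)^w) / 2], the sign
    vector of the clique function is a combination of two pure tensors, so its
    spectrum is [((1 - i) Z(i) + (1 + i) Z(-i)) / 2] where [Z(t)] is a product
    of one factor per variable.  If [m] of the transforms are Hadamard, then
    [Z(i) Z(-i) = 1] and [Z(t)^2 = e t^m] for [t = i, -i] and a common sign [e],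
    so the square of the spectrum is [1 + e i ((-i)^m - i^m) / 2]: this is [1]
    for [m] even, and [0] or [2] for [m] odd.  Hence flatness means that [m] is
    even, which holds for half of the [2^n] choices. *)
Require Import Defs.
From mathcomp Require Import all_boot all_order all_algebra.
From mathcomp Require Import complex.
From mathcomp Require Import reals.
From mathcomp Require Import ring.
Import Order.TTheory GRing.Theory Num.Theory.
Local Open Scope ring_scope.

Lemma F2_cases (a : 'F_2) : a = 0 \/ a = 1.
Proof. by case: a => [[|[|m]] //= lt_m]; [left | right]; apply: val_inj. Qed.

(** Summed over all [f], the sign (-1)^(number of [j] with [f j = h]) factors into one sum 1 - 1 = 0
    per element of [I]. Adding the constant 1 to each sign therefore leaves the total 2^#|I|, while
    every even [f] contributes 2 and every odd one 0. *)
Lemma card_even_ffun (I T : finType) (h : T) :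
  #|T| = 2 -> (0 < #|I|)%N ->
  #|[set f : {ffun I -> T} | ~~ odd (\sum_j (f j == h))]| = (2 ^ (#|I| - 1))%N.
Proof.
move=> T2 I0; set E := [set f | _].
have sum0 : \sum_(u : T) (-1) ^+ (u == h) = 0 :> int.
  rewrite (bigD1 h) //= eqxx (eq_bigr (fun=> 1)) => [|u /negPf-> //].
  rewrite sumr_const; suff -> : #|[pred u | u != h]| = 1%N by [].
  by have := cardC (pred1 h); rewrite card1 T2 => -[].
have sumE :
    \sum_(f : {ffun I -> T}) (-1) ^+ (\sum_j (f j == h))%N = 0 :> int.
  rewrite (eq_bigr (fun f : {ffun I -> T} => \prod_j (-1) ^+ (f j == h))).
    have /card_gt0P[j _] := I0.
    rewrite -(bigA_distr_bigA (fun _ u => (-1) ^+ (u == h))).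
    by rewrite (bigD1 j) //= sum0 mul0r.
  by move=> f _; rewrite expr_sum.
have : \sum_(f : {ffun I -> T}) (1 + (-1) ^+ (\sum_j (f j == h))%N) =
    (#|E| * 2)%:R :> int.
  rewrite (eq_bigr (fun f => if f \in E then 2 else 0)) => [|f _].
    by rewrite -big_mkcond sumr_const natrM mulr_natl.
  by rewrite inE -signr_odd; case: odd.
rewrite big_split /= sumE addr0 sumr_const card_ffun T2 => /eqP.
rewrite eqr_nat => /eqP eqE; apply/eqP; rewrite -(eqn_pmul2r (isT : 0 < 2)%N).
by rewrite -expnSr subn1 prednK // -eqE.
Qed.

Section Clique.
Variable C : numClosedFieldType.
Local Notation i := ('i : C).

Let ii : i * i = -1. Proof. by rewrite -expr2 sqrCi. Qed.

Definition clique_sum {n} (f : 'I_n -> 'F_2) : 'F_2 :=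
  \sum_(j < n) \sum_(l < n | (j < l)%N) f j * f l.

Lemma clique_sumS n (f : 'I_n.+1 -> 'F_2)
    (g := fun j => f (widen_ord (leqnSn n) j)) :
  clique_sum f = clique_sum g + (\sum_j g j) * f ord_max.
Proof.
rewrite /clique_sum big_ord_recr /= [X in _ + X]big1 ?addr0 => [|l].
  rewrite mulr_suml -big_split; apply: eq_bigr => j _ /=.
  by rewrite big_mkcond big_ord_recr -big_mkcond /= ltn_ord.
by rewrite ltnNge -ltnS ltn_ord.
Qed.

Lemma signF2D (a b : 'F_2) :
  (-1) ^+ ((a + b)%R : nat) = (-1) ^+ (a : nat) * (-1) ^+ (b : nat) :> C.
Proof.
by case: (F2_cases a) (F2_cases b) => -> [] ->;
  rewrite /= ?expr0 ?expr1 ?mulr1 ?mul1r ?mulrNN ?mulr1.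
Qed.

(* The second equation only serves to make the induction go through. *)
Lemma sign_clique_sum n (f : 'I_n -> 'F_2)
    (P := fun t : C => \prod_j t ^+ (f j : nat)) :
  (1 - i) * P i + (1 + i) * P (- i) = 2 * (-1) ^+ (clique_sum f : nat) /\
  i * ((1 - i) * P i - (1 + i) * P (- i)) =
    2 * (-1) ^+ (clique_sum f : nat) * (-1) ^+ ((\sum_j f j)%R : nat).
Proof.
rewrite {}/P; elim: n f => [|n IHn] f.
  rewrite /clique_sum !big_ord0 /= expr0.
  by split; [ring | ring: ii].
have prodS t : \prod_j t ^+ (f j : nat) =
    (\prod_j t ^+ (f (widen_ord (leqnSn n) j) : nat)) * t ^+ (f ord_max : nat) :> C.
  by rewrite big_ord_recr.
have sumS : \sum_j f j = \sum_j f (widen_ord (leqnSn n) j) + f ord_max.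
  by rewrite big_ord_recr.
have := IHn (fun j => f (widen_ord (leqnSn n) j)).
rewrite clique_sumS !prodS sumS !signF2D {prodS sumS}.
move: (clique_sum _) (\sum_j f _) (\prod_j i ^+ _) (\prod_j (- i) ^+ _) => q s P Q [].
case: (F2_cases (f ord_max)) => ->.
  by rewrite mulr0 !expr0 !mulr1.
(* A new bit 1 multiplies the products at i and -i by i and -i: this turns the left side of the
   first equation into that of the second, and that of the second into minus that of the first. *)
rewrite mulr1 !expr1 => E1 E2.
have ss : (-1) ^+ (s : nat) * (-1) ^+ (s : nat) = 1 :> C by rewrite -expr2 sqrr_sign.
split; first by rewrite [RHS]mulrA -E2; ring.
transitivity (- (2 * (-1) ^+ (q : nat)) : C); first by rewrite -E1; ring: ii.
by ring: ss.
Qed.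

(** The contribution of one variable to Z(t), obtained by applying [M] to the vector (1, t). *)
Definition row_gen (M : 'M[C]_2) (k : 'F_2) (t : C) : C :=
  bit_entry M k 0 + bit_entry M k 1 * t.

Lemma tensor_sum n (U : 'I_n -> 'M[C]_2) (k : 'rV_n) (t : C) :
  \sum_(x : 'rV['F_2]_n) tensor_entry U k x * \prod_j t ^+ (x 0 j : nat) =
  \prod_j row_gen (U j) (k 0 j) t.
Proof.
have -> : \prod_j row_gen (U j) (k 0 j) t =
    \prod_j \sum_(b : 'F_2) bit_entry (U j) (k 0 j) b * t ^+ (b : nat).
  apply: eq_bigr => j _; rewrite (bigD1 0) //= (bigD1 1) //= big1 => [|b].
    by rewrite expr0 expr1 mulr1 addr0.
  by case: (F2_cases b) => ->.
rewrite bigA_distr_bigA (reindex (fun f : {ffun 'I_n -> 'F_2} => \row_j f j)).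
  apply: eq_bigr => f _; rewrite -big_split; apply: eq_bigr => j _.
  by rewrite !mxE.
exists (fun x : 'rV_n => [ffun j => x 0 j]) => f _.
  by apply/ffunP => j; rewrite ffunE mxE.
by apply/rowP => j; rewrite mxE ffunE.
Qed.

Lemma spectrum_clique n (U : 'I_n -> 'M[C]_2) (k : 'rV_n)
    (Z := fun t => \prod_j row_gen (U j) (k 0 j) t) :
  2 * spectrum U (@clique n) k = (1 - i) * Z i + (1 + i) * Z (- i).
Proof.
rewrite /Z -!tensor_sum /spectrum !mulr_sumr -big_split; apply: eq_bigr => x _ /=.
rewrite mulrCA /sign_vector; have [<- _] := sign_clique_sum n (fun j => x 0 j).
by ring.
Qed.

Lemma hadamard_neq_id : hadamard C != idmx2 C.
Proof.
apply/eqP => /matrixP/(_ 0 1)/eqP; rewrite !mxE /= mulr1.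
by rewrite invr_eq0 sqrtC_eq0 pnatr_eq0.
Qed.

Lemma row_gen_id k t : row_gen (idmx2 C) k t = t ^+ (k : nat).
Proof.
by case: (F2_cases k) => ->;
  rewrite /row_gen /bit_entry !mxE /= ?mul0r ?mul1r ?addr0 ?add0r ?expr0 ?expr1.
Qed.

Lemma row_gen_hadamard k t :
  row_gen (hadamard C) k t = (sqrtC 2)^-1 * (1 + (-1) ^+ (k : nat) * t).
Proof.
by case: (F2_cases k) => ->;
  rewrite /row_gen /bit_entry !mxE /= ?expr0 ?expr1; ring.
Qed.

Let half_sqr : (sqrtC 2)^-1 * (sqrtC 2)^-1 = 2^-1 :> C.
Proof. by rewrite -invfM -expr2 sqrtCK. Qed.

(** For the identity the product is (-t^2)^k = 1; for Hadamard, with s = (-1)^k, it is (1 + st)(1 -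
    st)/2 = (1 - t^2)/2 = 1. *)
Lemma row_gen_mulN (M : 'M[C]_2) k t :
  M \in [:: idmx2 C; hadamard C] -> t * t = -1 ->
  row_gen M k t * row_gen M k (- t) = 1.
Proof.
rewrite !inE => /orP[] /eqP-> tt.
  by rewrite !row_gen_id -exprMn mulrN tt opprK expr1n.
have ss : (-1) ^+ (k : nat) * (-1) ^+ (k : nat) = 1 :> C by rewrite -expr2 sqrr_sign.
rewrite !row_gen_hadamard mulrACA half_sqr.
transitivity
  (2^-1 * (1 - ((-1) ^+ (k : nat) * (-1) ^+ (k : nat)) * (t * t)) : C).
  by ring.
by rewrite ss tt mul1r opprK mulVf // pnatr_eq0.
Qed.

(** For Hadamard, with s = (-1)^k, the square (1 + st)^2 / 2 collapses to st because t^2 = -1. The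
    identity yields only the sign, so the power of t counts Hadamard factors. *)
Lemma row_gen_sqr (M : 'M[C]_2) k t :
  M \in [:: idmx2 C; hadamard C] -> t * t = -1 ->
  row_gen M k t ^+ 2 = (-1) ^+ (k : nat) * t ^+ (M == hadamard C).
Proof.
rewrite !inE => /orP[] /eqP-> tt.
  by rewrite row_gen_id eq_sym (negPf hadamard_neq_id) mulr1 exprAC expr2 tt.
have ss : (-1) ^+ (k : nat) * (-1) ^+ (k : nat) = 1 :> C by rewrite -expr2 sqrr_sign.
rewrite row_gen_hadamard eqxx expr1 expr2 mulrACA half_sqr.
transitivity (2^-1 * (1 + 2 * ((-1) ^+ (k : nat) * t)
  + ((-1) ^+ (k : nat) * (-1) ^+ (k : nat)) * (t * t)) : C); first by ring.
by rewrite ss tt; field.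
Qed.

Lemma spectrum_clique_sqr n (U : 'I_n -> 'M[C]_2) (k : 'rV_n)
    (m := (\sum_j (U j == hadamard C))%N) :
  (forall j, U j \in [:: idmx2 C; hadamard C]) ->
  spectrum U (@clique n) k ^+ 2 =
  1 + (-1) ^+ (\sum_j (k 0%R j : nat))%N * i * ((- i) ^+ m - i ^+ m) / 2.
Proof.
move=> US; have /= := spectrum_clique n U k.
set Z := fun t => \prod_j row_gen (U j) (k 0 j) t.
have Z2 t : t * t = -1 -> Z t ^+ 2 = (-1) ^+ (\sum_j (k 0%R j : nat))%N * t ^+ m.
  move=> tt; rewrite /m !expr_sum -big_split -prodrXl; apply: eq_bigr => j _.
  exact: row_gen_sqr.
have ZN : Z i * Z (- i) = 1.
  by rewrite -big_split big1 // => j _; apply: row_gen_mulN.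
have := Z2 i ii; have := Z2 (- i); rewrite mulrNN => /(_ ii).
rewrite -/(Z i) -/(Z (- i)); move: ZN.
move: (Z i) (Z (- i)) (spectrum _ _ _) (i ^+ m) ((- i) ^+ m) (_ ^+ (\sum_j _)%N).
move=> X Y r a b e XY Y2 X2 Er.
have -> : r = 2^-1 * ((1 - i) * X + (1 + i) * Y) by rewrite -Er mulKf ?pnatr_eq0.
(* Expanded so that [X] and [Y] occur only through their squares and their product, all of which are
   known. *)
transitivity (4^-1 * ((1 - i) * (1 - i) * X ^+ 2 + (1 + i) * (1 + i) * Y ^+ 2
    + 2 * (1 - i * i) * (X * Y))); first by field.
rewrite XY X2 Y2.
transitivity (4^-1 * ((1 - 2 * i + i * i) * (e * a) + (1 + 2 * i + i * i) * (e * b)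
    + 2 * (1 - i * i))); first by ring.
by rewrite ii; field.
Qed.

(** The sign does not depend on t, so the powers at i and -i cancel in their difference when m is
    even, and differ by 2i up to sign when m is odd. *)
Lemma exp_sqrN1 (t : C) m : t * t = -1 -> t ^+ m = t ^+ odd m * (-1) ^+ odd m./2.
Proof.
move=> tt; rewrite -{1}(odd_double_half m) -muln2 mulnC exprD exprM expr2 tt.
by rewrite signr_odd.
Qed.

Lemma flat_clique n (U : 'I_n -> 'M[C]_2) :
  (forall j, U j \in [:: idmx2 C; hadamard C]) ->
  flat U (@clique n) = ~~ odd (\sum_j (U j == hadamard C)).
Proof.
move=> US; have /= := spectrum_clique_sqr n U _ US.
rewrite (exp_sqrN1 i) // (exp_sqrN1 (- i)) ?mulrNN //; set m := (\sum_j _)%N => sqr.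
apply/forallP/idP => [flatU | even k].
  (* For odd m every entry violates flatness; the one at 0 is an arbitrary choice. *)
  apply/negP => odd_m; have := flatU 0.
  rewrite -(@eqrXn2 _ 2) // expr1n -normrX sqr.
  rewrite odd_m !expr1 -(signr_odd _ (\sum_j _)).
  set e := (-1) ^+ _; set d := (-1) ^+ _.
  (* As [e] and [d] are signs, the squared entry 1 + ed is 0 or 2, never of modulus 1. *)
  have -> : 1 + e * i * (- i * d - i * d) / 2 = 1 - e * d * (i * i) by field.
  rewrite ii /e /d -signr_addb mulrN1 opprK.
  case: (_ (+) _); rewrite ?expr1 ?expr0 ?subrr ?normr0.
    by rewrite eq_sym oner_eq0.
  by rewrite -(natrD _ 1 1) normr_nat pnatr_eq1.
rewrite -(@eqrXn2 _ 2) // expr1n -normrX sqr.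
by rewrite (negPf even) !expr0 subrr mulr0 mul0r addr0 normr1.
Qed.

Lemma num_flat_clique n : (0 < n)%N ->
  num_flat_spectra [:: idmx2 C; hadamard C] (@clique n) = (2 ^ (n - 1))%N.
Proof.
move=> n0; set S := [:: _; _].
have hS : hadamard C \in S by rewrite !inE eqxx orbT.
have := @card_even_ffun 'I_n (seq_sub S) (SeqSub hS).
(* The two matrices being distinct, each factor has exactly two choices. *)
rewrite card_seq_sub /= ?inE 1?eq_sym ?hadamard_neq_id // card_ord => <- //.
apply: eq_card => U; rewrite !inE flat_clique // => j; exact: ssvalP.
Qed.

End Clique.

Theorem lemma5 (R : realType) (n : nat) (hn : (1 <= n)%N) :
  num_flat_spectra [:: idmx2 R[i]; hadamard R[i]] (@clique n) = (2 ^ (n - 1))%N.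
Proof. exact: num_flat_clique. Qed.
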